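(* Let $(\boldsymbol{L};\boldsymbol{V})$ be a nonnegative pair with $\boldsymbol{L}\in\mathbb{R}^{n\times n}$, $\boldsymbol{V}\in\mathbb{R}^{n\times p}$. Let $\boldsymbol{Q}\in\mathbb{R}^{n\times p}$ be an orthonormal basis of $\operatorname{span}\boldsymbol{V}$, let $\widetilde{\boldsymbol{L}}=(\boldsymbol{I}-\boldsymbol{Q}\boldsymbol{Q}^\top)\boldsymbol{L}(\boldsymbol{I}-\boldsymbol{Q}\boldsymbol{Q}^\top)$, let $q=\operatorname{rank}\widetilde{\boldsymbol{L}}$, and let $\widetilde{\boldsymbol{L}}=\widetilde{\boldsymbol{U}}\widetilde{\boldsymbol{\Lambda}}\widetilde{\boldsymbol{U}}^\top$ be its truncated spectral decomposition, where $\widetilde{\boldsymbol{\Lambda}}=\operatorname{diag}(\widetilde\lambda_1,\dots,\widetilde\lambda_q)$ contains the nonzero eigenvalues and $\widetilde{\boldsymbol{U}}\in\mathbb{R}^{n\times q}$ the corresponding orthonormal eigenvectors. Then for any subset $X\subseteq\{1,\dots,n\}$ of size $|X|=m$ with $p\le m\le p+q$, $$(-1)^p\det\begin{pmatrix}\boldsymbol{L}_X&\boldsymbol{V}_{X,:}\\(\boldsymbol{V}_{X,:})^\top&\boldsymbol{0}\end{pmatrix}=\det(\boldsymbol{V}^\top\boldsymbol{V})\sum_{Y\subseteq\{1,\dots,q\},\,|Y|=m-p}\Big(\det\begin{bmatrix}\boldsymbol{Q}_{X,:}&\widetilde{\boldsymbol{U}}_{X,Y}\end{bmatrix}\Big)^2\prod_{i\in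 Y}\widetilde\lambda_i .$$
   Context: For a matrix $\boldsymbol{M}$, $\boldsymbol{M}_X$ is the submatrix with rows and columns in $X$, $\boldsymbol{M}_{X,:}$ the submatrix of rows in $X$, and $\boldsymbol{M}_{X,Y}$ the submatrix with rows in $X$ and columns in $Y$. Nonnegative pair (NNP): a pair $(\boldsymbol{L};\boldsymbol{V})$ with $\boldsymbol{L}\in\mathbb{R}^{n\times n}$ symmetric, $\boldsymbol{V}\in\mathbb{R}^{n\times p}$ of full column rank, $0\le p\le n$, such that $\boldsymbol{L}$ is conditionally positive semi-definite with respect to $\boldsymbol{V}$, i.e. $\boldsymbol{x}^\top\boldsymbol{L}\boldsymbol{x}\ge 0$ for every $\boldsymbol{x}\in\mathbb{R}^n$ with $\boldsymbol{V}^\top\boldsymbol{x}=0$. (If $p=0$, $\boldsymbol{V}$ and $\boldsymbol{Q}$ are empty and $\widetilde{\boldsymbol{L}}=\boldsymbol{L}$; determinants of empty matrices and empty products equal $1$.) *)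

(* Defs.v *)
From HB Require Import structures.
From mathcomp Require Import all_boot all_order all_algebra.

Set Implicit Arguments.
Unset Strict Implicit.
Unset Printing Implicit Defensive.

Import Order.TTheory GRing.Theory Num.Theory.
Local Open Scope ring_scope.

(* Rows and columns are kept in increasing order: enum_val lists a set of
   ordinals increasingly. *)
Definition submatrix (R : Type) (n k : nat) (X : {set 'I_n}) (Y : {set 'I_k})
    (A : 'M[R]_(n, k)) : 'M[R]_(#|X|, #|Y|) :=
  mxsub (fun i : 'I_#|X| => enum_val i) (fun j : 'I_#|Y| => enum_val j) A.

Definition subrows (R : Type) (n k : nat) (X : {set 'I_n})
    (A : 'M[R]_(n, k)) : 'M[R]_(#|X|, k) :=
  rowsub (fun i : 'I_#|X| => enum_val i) A.

(* Determinant of a matrix whose two dimensions are equal, but not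
   convertibly so (such as #|X| and p + #|Y|).  The value is meaningless when
   m <> k. *)
Definition cast_det (R : comNzRingType) (m k : nat) (A : 'M[R]_(m, k)) : R :=
  \det (conform_mx (0 : 'M[R]_m) A).

Definition cond_psd (R : rcfType) (n p : nat)
    (L : 'M[R]_n) (V : 'M[R]_(n, p)) : Prop :=
  forall x : 'cV[R]_n, V^T *m x = 0 -> 0 <= (x^T *m L *m x) 0 0.

Record nonneg_pair (R : rcfType) (n p : nat)
    (L : 'M[R]_n) (V : 'M[R]_(n, p)) : Prop := NonnegPair {
  nnp_dim : (p <= n)%N;
  nnp_sym : L^T = L;
  nnp_rank : \rank V = p;
  nnp_psd : cond_psd L V }.

Definition orthonormal_cols (R : rcfType) (n k : nat)
    (Q : 'M[R]_(n, k)) : Prop :=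
  Q^T *m Q = 1%:M.

(* (_ == _)%MS compares row spaces, hence the
   transposes for the column span of V. *)
Definition orthonormal_basis (R : rcfType) (n p : nat)
    (Q V : 'M[R]_(n, p)) : Prop :=
  orthonormal_cols Q /\ (Q^T == V^T)%MS.

Definition projected (R : rcfType) (n p : nat)
    (L : 'M[R]_n) (Q : 'M[R]_(n, p)) : 'M[R]_n :=
  (1%:M - Q *m Q^T) *m L *m (1%:M - Q *m Q^T).

(* When q is the rank of A, the entries of lam are all the nonzero eigenvalues
   of A, repeated according to multiplicity. *)
Record truncated_spectral (R : rcfType) (n q : nat) (A : 'M[R]_n)
    (U : 'M[R]_(n, q)) (lam : 'rV[R]_q) : Prop := TruncatedSpectral {
  tsd_neq0 : forall i, lam 0 i != 0;
  tsd_eigen : forall i, A *m col i U = lam 0 i *: col i U;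
  tsd_orthonormal : orthonormal_cols U;
  tsd_decomp : A = U *m diag_mx lam *m U^T }.

(* Main.v *)
Require Import Defs.
From HB Require Import structures.
From mathcomp Require Import all_boot all_order all_algebra.

Set Implicit Arguments.
Unset Strict Implicit.
Unset Printing Implicit Defensive.

Import Order.TTheory GRing.Theory Num.Theory.
Local Open Scope ring_scope.

(** The determinant of the saddle-point matrix [N A; A^T 0] only sees N up to
    terms A C + D A^T, and picks up det(B)^2 when A is replaced by A B.  Since V
    = Q B with B square and L - projected L Q = Q C + D Q^T, the left-hand side
    is therefore det(B)^2 = det(V^T V) times the determinant of the projected
    matrix U diag(lam) U^T bordered by Q, all restricted to the rows in X.

    What remains is a Cauchy-Binet formula for bordered matrices
    (det_bordered_Cauchy_Binet): for N = sum_i c_i b_i b_i^T, the determinant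
    of N bordered by A expands over the sets Y of indices such that Y and A
    together provide exactly m vectors.  It comes from one identity
    (det_bordered_rank1): adding c b b^T to N changes the determinant by -c
    times the determinant of N bordered by [A b], i.e. the vector b is moved
    from the core to the border.  Moving the b_i one by one ends with N = 0
    bordered by p + |Y| columns, whose determinant vanishes unless the border
    is square.  The coefficient of each surviving Y is the same determinant
    with all weights 1, and for a square matrix [A C] it factors as
    (-1)^p det([A C])^2 (det_bordered_gram). *)

(** * Rank-one updates of bordered matrices *)

Definition bordered (R : nzRingType) (m p : nat) (N : 'M[R]_m)
    (A : 'M[R]_(m, p)) : 'M[R]_(m + p) :=
  block_mx N A A^T 0.

Lemma det_castmx (R : comNzRingType) (m n : nat) (e : m = n) (A : 'M[R]_m) :
  \det (castmx (e, e) A) = \det A.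
Proof. by case: n / e; rewrite castmx_id. Qed.

(** This is det(M + c u v) = det M + c v adj(M) u with the adjugate term written
    as a bordered determinant.  By a Schur complement, the left-hand side is the
    determinant of [M -cu; v 1]; its last row is the sum of (v 0) and (0 1). *)
Lemma det_rank1_update (R : comNzRingType) (k : nat) (M : 'M[R]_k)
    (u : 'cV[R]_k) (v : 'rV[R]_k) (c : R) :
  \det (M + c *: (u *m v)) = \det M - c * \det (block_mx M u v 0).
Proof.
have ->: \det (M + c *: (u *m v)) = \det (block_mx M (- (c *: u)) v 1%:M).
  have det_shear : \det (block_mx 1%:M (c *: u) 0 (1%:M : 'M[R]_1)) = 1.
    by rewrite det_ublock !det1 mulr1.
  rewrite -[RHS]mul1r -[X in _ = X * _]det_shear.
  rewrite -det_mulmx mulmx_block !mul1mx !mul0mx !mulmx1 add0r addNr add0r.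
  by rewrite det_lblock det1 mulr1 scalemxAl.
have detN : \det (block_mx M (- (c *: u)) v (0 : 'M_1))
    = - c * \det (block_mx M u v 0).
  have ->: block_mx M (- (c *: u)) v (0 : 'M_1)
      = block_mx M u v 0 *m block_mx 1%:M 0 0 (- c)%:M.
    rewrite mulmx_block !mulmx1 !mulmx0 !addr0 !add0r mul0mx.
    by rewrite mul_mx_scalar scaleNr.
  by rewrite det_mulmx det_ublock det1 mul1r det_scalar1 mulrC.
rewrite -mulNr -detN.
have -> : \det M = \det (block_mx M (- (c *: u)) 0 (1%:M : 'M_1)).
  by rewrite det_ublock det1 mulr1.
rewrite -[RHS]addr0 -[X in X + _ + _]mul1r -[X in _ + X + _]mul1r addr0.
apply: (determinant_multilinear (i0 := rshift k (0 : 'I_1))).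
- by rewrite !scale1r !block_mxEv !rowKd !row_id add_row_mx add0r addr0.
- rewrite !block_mxEv !row'Kd; congr (castmx _ (col_mx _ _)).
  by rewrite ![row' _ _]flatmx0.
- rewrite !block_mxEv !row'Kd; congr (castmx _ (col_mx _ _)).
  by rewrite ![row' _ _]flatmx0.
Qed.

Lemma det_bordered_rank1 (R : comNzRingType) (m p : nat) (N : 'M[R]_m)
    (A : 'M[R]_(m, p)) (b : 'cV[R]_m) (c : R) :
  \det (bordered (N + c *: (b *m b^T)) A)
  = \det (bordered N A) - c * \det (bordered N (row_mx A b)).
Proof.
have -> : bordered (N + c *: (b *m b^T)) A
    = bordered N A + c *: (col_mx b 0 *m row_mx b^T 0).
  rewrite mul_col_row !mulmx0 mul0mx scale_block_mx add_block_mx !scaler0.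
  by rewrite !addr0.
rewrite det_rank1_update; congr (_ - _ * _).
rewrite /bordered tr_row_mx -(block_mx0 R p 1 p 1).
by rewrite block_mxA det_castmx.
Qed.

(** The two off-diagonal blocks have rank at most min m p each, so the rank is
    at most 2 min m p, which is below m + p. *)
Lemma det_bordered0 (F : fieldType) (m p : nat) (A : 'M[F]_(m, p)) :
  m != p -> \det (bordered 0 A) = 0.
Proof.
move=> neq_mp; apply/eqP; apply: contraLR neq_mp => detN0.
have: bordered 0 A \in unitmx by rewrite unitmxE unitfE.
move/mxrank_unit => rk; rewrite negbK.
have rkA : (m + p <= \rank A + \rank A)%N.
  rewrite -[X in (X <= _)%N]rk /bordered block_mxEv.
  have -> : col_mx (row_mx 0 A) (row_mx A^T 0)
     = col_mx (row_mx (0 : 'M_m) A) 0 + col_mx 0 (row_mx A^T (0 : 'M_p)).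
    by rewrite add_col_mx addr0 add0r.
  apply: leq_trans (mxrank_add _ _) _.
  by rewrite rank_col_mx0 rank_col_0mx rank_row_0mx rank_row_mx0 mxrank_tr.
have := rank_leq_row A; have := rank_leq_col A.
move: (\rank A) rkA => r h1 h2 h3.
rewrite eqn_leq -(leq_add2r p m p) -(leq_add2l m p m).
by rewrite (leq_trans h1 (leq_add h2 h2)) (leq_trans h1 (leq_add h3 h3)).
Qed.

(** * Expansion over subsets of columns *)

Definition wgram (R : nzRingType) (m q : nat) (c : 'I_q -> R) (B : 'M[R]_(m, q))
    (S : {set 'I_q}) : 'M[R]_m :=
  \sum_(i in S) c i *: (col i B *m (col i B)^T).

Lemma wgram0 (R : nzRingType) (m q : nat) (c : 'I_q -> R) (B : 'M[R]_(m, q)) :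
  wgram c B set0 = 0.
Proof. by rewrite /wgram big_set0. Qed.

Lemma det_bordered_wgramU1 (R : comNzRingType) (m p q : nat) (c : 'I_q -> R)
    (B : 'M[R]_(m, q)) (A : 'M[R]_(m, p)) (i : 'I_q) (S : {set 'I_q}) :
  i \notin S ->
  \det (bordered (wgram c B (i |: S)) A)
  = \det (bordered (wgram c B S) A)
    - c i * \det (bordered (wgram c B S) (row_mx A (col i B))).
Proof.
move=> iS; rewrite -det_bordered_rank1 /wgram big_setU1 //=.
by rewrite [X in \det (bordered X _) = _]addrC.
Qed.

Lemma set_ind (T : finType) (P : {set T} -> Prop) :
  P set0 -> (forall x (S : {set T}), x \notin S -> P S -> P (x |: S)) -> forall S, P S.
Proof.
move=> P0 PU S; elim: {S}#|S| {-2}S (erefl #|S|) => [|k IH] S cS.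
  by rewrite (cards0_eq cS).
have /card_gt0P[x xS] : (0 < #|S|)%N by rewrite cS.
rewrite -(setD1K xS); apply: PU; first by rewrite !inE eqxx.
by apply: IH; move: cS; rewrite (cardsD1 x) xS => -[].
Qed.

(** Moving a column to the border does not increase the number of vectors in
    use, so no term of the expansion ever reaches a square border. *)
Lemma det_bordered_wgram_small (F : fieldType) (m q : nat) (c : 'I_q -> F)
    (B : 'M[F]_(m, q)) (S : {set 'I_q}) (p : nat) (A : 'M[F]_(m, p)) :
  (#|S| + p < m)%N -> \det (bordered (wgram c B S) A) = 0.
Proof.
elim/set_ind: S p A => [|i S iS IH] p A.
  by rewrite cards0 wgram0 => lt_pm; rewrite det_bordered0 // gtn_eqF.
rewrite cardsU1 iS addSn => lt_Sm.
rewrite det_bordered_wgramU1 // !IH ?mulr0 ?subr0 //; last exact: ltnW.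
by rewrite addn1 addnS.
Qed.

(** Induction on S, for all borders at once: the sets Y avoiding the new index i
    come from S bordered by A, those containing i from S bordered by A and the
    column i.  In the latter case the unit-weight determinant of i |: Y bordered
    by A is identified by the same rank-one identity. *)
Lemma det_bordered_wgram (F : fieldType) (m q : nat) (c : 'I_q -> F)
    (B : 'M[F]_(m, q)) (S : {set 'I_q}) (p : nat) (A : 'M[F]_(m, p)) :
  \det (bordered (wgram c B S) A)
  = \sum_(Y : {set 'I_q} | (Y \subset S) && (#|Y| + p == m)%N)
      (\prod_(i in Y) c i) * \det (bordered (wgram (fun=> 1) B Y) A).
Proof.
elim/set_ind: S p A => [|i S iS IH] p A.
  under eq_bigl => Y do rewrite subset0.
  have [eq_pm|neq_pm] := eqVneq m p.
    rewrite (big_pred1 set0) => [|Y]; last first.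
      by rewrite /=; case: eqVneq => [->|//]; rewrite cards0 add0n eq_pm eqxx.
    by rewrite big_set0 mul1r !wgram0.
  rewrite big_pred0 => [|Y]; first by rewrite wgram0 det_bordered0.
  rewrite /=; case: eqVneq => [->|//].
  by rewrite cards0 add0n eq_sym (negPf neq_pm).
rewrite det_bordered_wgramU1 // !IH [RHS](bigID (fun Y : {set 'I_q} => i \in Y)) /=.
rewrite [RHS]addrC; congr (_ + _).
  apply: eq_bigl => Y.
  rewrite andbAC; congr (_ && _); apply/idP/andP => [sYS | [sYS iY]].
    split; first exact: subset_trans sYS (subsetUr _ _).
    by apply: contra iS => /(subsetP sYS).
  apply/subsetP=> j jY; have /setU1P[eji|//] := subsetP sYS _ jY.
  by rewrite -eji jY in iY.
rewrite mulr_sumr -sumrN.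
rewrite [RHS](reindex_onto (fun Y => i |: Y) (fun Y => Y :\ i)) /=; last first.
  by move=> Y /andP[_ iY]; rewrite setD1K.
apply: eq_big => [Y | Y /andP[sYS /eqP cY]].
  rewrite setU11 andbT.
  have [iY|iY] := boolP (i \in Y).
    rewrite [Y \subset S](contraNF _ iS) /=; last by move/subsetP; apply.
    apply/esym/negbTE; apply/negP => /andP[_ /eqP eY].
    by move: iY; rewrite -eY !inE eqxx.
  rewrite setU1K // eqxx andbT cardsU1 iY addSn addn1 addnS; congr (_ && _).
  apply/idP/idP => [sYS | /subsetP sYS]; first exact: setUS.
  apply/subsetP => j jY; have /setU1P[eji|//] := sYS _ (setU1r i jY).
  by rewrite -eji jY in iY.
have iY : i \notin Y by apply: contra iS => /(subsetP sYS).
rewrite big_setU1 //= det_bordered_wgramU1 // mul1r.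
(* Y together with the columns of A is one vector short of m. *)
rewrite [X in _ = _ * (X - _)]det_bordered_wgram_small; last first.
  by rewrite -cY addn1 addnS.
by rewrite sub0r mulrA mulrN.
Qed.

(** Writing K = [A C], the bordered matrix is the congruence by diag(K, I) of its
    special case K = I, whose determinant is (-1)^p. *)
Lemma det_bordered_gram (R : comNzRingType) (p k : nat)
    (A : 'M[R]_(p + k, p)) (C : 'M[R]_(p + k, k)) :
  \det (bordered (C *m C^T) A) = (-1) ^+ p * \det (row_mx A C) ^+ 2.
Proof.
pose J : 'M[R]_(p + k, p) := col_mx 1%:M 0.
pose E : 'M[R]_(p + k) := block_mx 0 0 0 1%:M.
have detG : \det (bordered E J) = (-1) ^+ p.
  have: \det (block_mx 1%:M 0 (- J^T) 1%:M
              *m (block_mx 1%:M J 0 1%:M *m bordered E J))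
      = \det (bordered E J).
    by rewrite !det_mulmx det_lblock det_ublock !det1 !mul1r.
  move<-; rewrite /bordered !mulmx_block !mul1mx !mul0mx !mulmx0 !add0r !addr0.
  have -> : E + J *m J^T = 1%:M.
    rewrite /E /J tr_col_mx trmx0 trmx1 mul_col_row !mulmx0 mul0mx mulmx1.
    by rewrite add_block_mx !addr0 add0r -scalar_mx_block.
  rewrite mulmx1 addNr mulNmx tr_col_mx trmx0 trmx1 mul_row_col mul1mx mul0mx addr0.
  by rewrite det_ublock det1 mul1r -scaleN1r detZ det1 mulr1.
have -> : bordered (C *m C^T) A
    = block_mx (row_mx A C) 0 0 1%:M *m bordered E J
      *m block_mx (row_mx A C)^T 0 0 1%:M.
  rewrite /bordered !mulmx_block !mul0mx !mulmx0 !mulmx1 !mul1mx !addr0 !add0r.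
  have KJ : row_mx A C *m J = A.
    by rewrite mul_row_col mulmx1 mulmx0 addr0.
  have KE : row_mx A C *m E = row_mx 0 C.
    by rewrite mul_row_block !mulmx0 mulmx1 addr0 add0r.
  by rewrite -trmx_mul KJ KE tr_row_mx mul_row_col mul0mx add0r.
rewrite !det_mulmx detG !det_ublock det_tr !det1 !mulr1 mulrC mulrA.
by rewrite mulrC expr2.
Qed.

Lemma wgramT (R : comNzRingType) (m q : nat) (d : 'rV[R]_q) (B : 'M[R]_(m, q)) :
  B *m diag_mx d *m B^T = wgram (d 0) B setT.
Proof.
apply/matrixP=> i j; rewrite /wgram !mxE summxE.
apply: eq_big => [k | k _]; first by rewrite inE.
rewrite mul_mx_diag !mxE big_ord1 !mxE.
by rewrite mulrAC mulrC.
Qed.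

Lemma wgram1 (R : nzRingType) (m q : nat) (B : 'M[R]_(m, q)) (Y : {set 'I_q}) :
  let BY := colsub (fun j : 'I_#|Y| => enum_val j) B in
  wgram (fun=> 1) B Y = BY *m BY^T.
Proof.
apply/matrixP=> i j; rewrite /wgram !mxE summxE big_enum_val.
by apply: eq_bigr => k _; rewrite !mxE big_ord1 !mxE mul1r.
Qed.

Lemma det_bordered_gram_cast (R : comNzRingType) (m p k : nat)
    (A : 'M[R]_(m, p)) (C : 'M[R]_(m, k)) :
  m = (p + k)%N ->
  \det (bordered (C *m C^T) A) = (-1) ^+ p * cast_det (row_mx A C) ^+ 2.
Proof.
by move=> e; subst m; rewrite det_bordered_gram /cast_det conform_mx_id.
Qed.

(** The minors on the right are those of [A B] that use all the columns of A. *)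
Lemma det_bordered_Cauchy_Binet (F : fieldType) (m p q : nat)
    (A : 'M[F]_(m, p)) (B : 'M[F]_(m, q)) (d : 'rV[F]_q) : (p <= m)%N ->
  (-1) ^+ p * \det (bordered (B *m diag_mx d *m B^T) A)
  = \sum_(Y : {set 'I_q} | #|Y| == (m - p)%N)
      cast_det (row_mx A (colsub (fun j : 'I_#|Y| => enum_val j) B)) ^+ 2
      * \prod_(i in Y) d 0 i.
Proof.
move=> le_pm; rewrite wgramT det_bordered_wgram mulr_sumr.
apply: eq_big => [Y | Y /andP[_ /eqP cY]].
  by rewrite subsetT /= -[in LHS](subnK le_pm) eqn_add2r.
rewrite wgram1 det_bordered_gram_cast; last by rewrite -cY addnC.
by rewrite mulrCA signrMK mulrC.
Qed.

(** * Reduction to the projected matrix *)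

(** Multiples of the border can be cleared from the core by row and column
    operations. *)
Lemma det_bordered_shift (R : comNzRingType) (m p : nat) (N : 'M[R]_m)
    (A D : 'M[R]_(m, p)) (C : 'M[R]_(p, m)) :
  \det (bordered (N + A *m C + D *m A^T) A) = \det (bordered N A).
Proof.
have -> : bordered (N + A *m C + D *m A^T) A
    = block_mx 1%:M D 0 1%:M *m (bordered N A *m block_mx 1%:M 0 C 1%:M).
  rewrite /bordered !mulmx_block !mul1mx !mul0mx !mulmx1 !mulmx0.
  by rewrite !addr0 !add0r mulmx0 addr0.
by rewrite !det_mulmx det_ublock det_lblock !det1 !mul1r mulr1.
Qed.

Lemma det_bordered_mulmx (R : comNzRingType) (m p : nat) (N : 'M[R]_m)
    (A : 'M[R]_(m, p)) (B : 'M[R]_p) :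
  \det (bordered N (A *m B)) = \det B ^+ 2 * \det (bordered N A).
Proof.
have -> : bordered N (A *m B)
    = block_mx 1%:M 0 0 B^T *m (bordered N A *m block_mx 1%:M 0 0 B).
  rewrite /bordered trmx_mul !mulmx_block !mul1mx !mul0mx !mulmx1 !mulmx0.
  by rewrite !addr0 !add0r ?mul0mx ?mulmx0 ?mul0mx.
by rewrite !det_mulmx !det_ublock det_tr !det1 !mul1r mulrCA mulrC expr2.
Qed.

(** With P = Q Q^T, this is L = (1 - P) L (1 - P) + P L + (1 - P) L P; the last
    two terms have the shape cleared by det_bordered_shift. *)
Lemma projected_decomp (R : rcfType) (n p : nat) (L : 'M[R]_n) (Q : 'M[R]_(n, p)) :
  L = projected L Q + Q *m (Q^T *m L) + ((1%:M - Q *m Q^T) *m L *m Q) *m Q^T.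
Proof.
rewrite /projected mulmxBr mulmx1 !mulmxA addrAC subrK mulmxBl mul1mx.
by rewrite subrK.
Qed.

Theorem theorem2p13 (R : rcfType) (n p q : nat)
    (L : 'M[R]_n) (V Q : 'M[R]_(n, p)) (U : 'M[R]_(n, q)) (lam : 'rV[R]_q)
    (hLV : nonneg_pair L V)
    (hQ : orthonormal_basis Q V)
    (hq : q = \rank (projected L Q))
    (hU : truncated_spectral (projected L Q) U lam)
    (m : nat) (X : {set 'I_n}) (hX : #|X| = m)
    (hm : (p <= m <= p + q)%N) :
  (-1) ^+ p * \det (block_mx (submatrix X X L) (subrows X V)
                             (subrows X V)^T   0)
  = \det (V^T *m V) *
    \sum_(Y : {set 'I_q} | #|Y| == (m - p)%N)
      cast_det (row_mx (subrows X Q) (submatrix X Y U)) ^+ 2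
      * \prod_(i in Y) lam 0 i.
Proof.
have [QTQ /andP[_ /submxP[D VT]]] := hQ.
have defV : V = Q *m D^T by rewrite -[V]trmxK VT trmx_mul trmxK.
have detVV : \det (V^T *m V) = \det D^T ^+ 2.
  rewrite VT defV mulmxA -(mulmxA D) QTQ mulmx1 det_mulmx -(det_tr D).
  by rewrite expr2.
have VX : subrows X V = subrows X Q *m D^T by rewrite defV mul_rowsub_mx.
have LX : submatrix X X L = subrows X U *m diag_mx lam *m (subrows X U)^T
    + subrows X Q *m (colsub (fun i : 'I_#|X| => enum_val i) (Q^T *m L))
    + subrows X ((1%:M - Q *m Q^T) *m L *m Q) *m (subrows X Q)^T.
  rewrite [in LHS](projected_decomp L Q) (tsd_decomp hU).
  by rewrite /submatrix /subrows !linearD /= !trmx_mxsub mul_rowsub_mx -!mxsub_mul.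
rewrite -/(bordered _ _) VX det_bordered_mulmx LX det_bordered_shift detVV mulrCA.
have [le_pm _] := andP hm.
rewrite -hX det_bordered_Cauchy_Binet ?hX //; congr (_ * _).
apply: eq_bigr => Y _; congr (cast_det (row_mx _ _) ^+ 2 * _).
exact/esym/mxsubcr.
Qed.
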